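(* Let $\mathcal{U}$ be a free ultrafilter on $\mathbb{N}$, let $(X_n)_{n\in\mathbb{N}}$ be a sequence of GL-spaces, and let $Z=\prod_{n,\mathcal{U}}X_n$ be their ultraproduct. Then for every $z\in S_Z$ there is a functional $z^*\in S_{Z^*}$ with $z^*(z)=1$ such that for every $y\in S_Z$ there are $z_1,z_2\in S_Z$ with $z^*(z_1)=1=-z^*(z_2)$ and $\|y-z_1\|+\|y-z_2\|=2$. In particular, $Z$ is also a GL-space.
   Context: All Banach spaces are real. For a Banach space $X$, $B_X$ is the closed unit ball, $S_X$ the unit sphere, $X^*$ the dual. For $x^*\in S_{X^*}$ and $\varepsilon>0$ put $S(x^*,\varepsilon)=\{x\in B_X: x^*(x)>1-\varepsilon\}$, and $-S(x^*,\varepsilon)=\{-x: x\in S(x^*,\varepsilon)\}$. For $A\subseteq X$, $\operatorname{d}(x,A)$ is the distance from $x$ to $A$. $X$ is called a generalised lush (GL) space if for every $x\in S_X$ and every $\varepsilon>0$ there is $x^*\in S_{X^*}$ such that $x\in S(x^*,\varepsilon)$ and $\operatorname{d}(y,S(x^*,\varepsilon))+\operatorname{d}(y,-S(x^*,\varepsilon))<2+\varepsilon$ for all $y\in S_X$. Ultraproduct: for a free ultrafilter $\mathcal{U}$ on $\mathbb{N}$ and a bounded real sequence $(a_n)$, $\lim_{n,\mathcal{U}}a_n$ denotes the unique $a\in\mathbb{R}$ with $\{n: |a_n-a|<\varepsilon\}\in\mathcal{U}$ for every $\varepsilon>0$. Let $\ell^\infty((X_n)_{n\in\mathbb{N}})$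 be the space of all sequences $(x_n)\in\prod_n X_n$ with $\sup_n\|x_n\|<\infty$, and $\mathcal{N}_{\mathcal{U}}=\{(x_n)\in\ell^\infty((X_n)_{n\in\mathbb{N}}):\lim_{n,\mathcal{U}}\|x_n\|=0\}$. Then $\prod_{n,\mathcal{U}}X_n:=\ell^\infty((X_n)_{n\in\mathbb{N}})/\mathcal{N}_{\mathcal{U}}$ with the norm $\|[(x_n)]\|_{\mathcal{U}}=\lim_{n,\mathcal{U}}\|x_n\|$, which is a Banach space. *)

(* Defs.v *)
From HB Require Import structures.
From mathcomp Require Import all_boot all_order all_algebra.
From mathcomp Require Import ring_quotient generic_quotient lra.
From mathcomp Require Import all_classical all_reals all_analysis.

Set Implicit Arguments.
Unset Strict Implicit.
Unset Printing Implicit Defensive.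

Import Order.TTheory GRing.Theory Num.Theory.
Import numFieldNormedType.Exports.

Local Open Scope classical_set_scope.
Local Open Scope ring_scope.

Section gl_space.
Context (R : realType) (X : completeNormedModType R).
Implicit Types (f : {linear X -> R^o}) (eps : R).

Definition unit_ball : set X := [set x | `|x| <= 1].

Definition unit_sphere : set X := [set x | `|x| = 1].

(* A total function: [sup] returns 0 when f is unbounded on the unit ball,
   hence the continuity requirement in [dual_sphere]. *)
Definition dual_norm f : R := sup [set `|f x| | x in unit_ball].

Definition dual_sphere : set {linear X -> R^o} :=
  [set f : {linear X -> R^o} | continuous f /\ dual_norm f = 1].

Definition slice f eps : set X := [set x | unit_ball x /\ 1 - eps < f x].

Definition opp_slice f eps : set X := [set - x | x in slice f eps].

Definition GL_space : Prop :=
  forall x, unit_sphere x -> forall eps, 0 < eps ->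
  exists f, [/\ dual_sphere f, slice f eps x &
    forall y, unit_sphere y ->
      (edist_inf (slice f eps) y + edist_inf (opp_slice f eps) y
         < (2 + eps)%:E)%E].

End gl_space.

Definition free_filter (T : Type) (F : set_system T) : Prop :=
  \bigcap_(A in F) A = set0.

Section seq_product.
Context (R : realType) (X : nat -> completeNormedModType R).

Definition seq_product : Type := forall n, X n.

HB.instance Definition _ := gen_eqMixin seq_product.
HB.instance Definition _ := gen_choiceMixin seq_product.

Implicit Types x y z : seq_product.

Let zero : seq_product := fun=> 0.
Let opp x : seq_product := fun n => - x n.
Let add x y : seq_product := fun n => x n + y n.
Let scale (a : R) x : seq_product := fun n => a *: x n.

Let addA : associative add.
Proof. by move=> x y z; apply: functional_extensionality_dep => n; exact: addrA. Qed.
Let addC : commutative add.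
Proof. by move=> x y; apply: functional_extensionality_dep => n; exact: addrC. Qed.
Let add0 : left_id zero add.
Proof. by move=> x; apply: functional_extensionality_dep => n; exact: add0r. Qed.
Let addN : left_inverse zero opp add.
Proof. by move=> x; apply: functional_extensionality_dep => n; exact: addNr. Qed.

HB.instance Definition _ :=
  GRing.isZmodule.Build seq_product addA addC add0 addN.

Let scaleA a b x : scale a (scale b x) = scale (a * b) x.
Proof. by apply: functional_extensionality_dep => n; exact: scalerA. Qed.
Let scale1 : left_id 1 scale.
Proof. by move=> x; apply: functional_extensionality_dep => n; exact: scale1r. Qed.
Let scaleDr : right_distributive scale +%R.
Proof. by move=> a x y; apply: functional_extensionality_dep => n; exact: scalerDr. Qed.
Let scaleDl x : {morph scale^~ x : a b / a + b}.
Proof. by move=> a b; apply: functional_extensionality_dep => n; exact: scalerDl. Qed.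

HB.instance Definition _ :=
  GRing.Zmodule_isLmodule.Build R seq_product scaleA scale1 scaleDr scaleDl.

Definition bounded_seq : {pred seq_product} :=
  [pred x : seq_product | `[< exists M : R, forall n, `|x n| <= M >]].

Lemma bounded_seq_submod_closed : submod_closed bounded_seq.
Proof.
split; first by apply/asboolP; exists 0 => n; rewrite normr0.
move=> a x y /asboolP[M xM] /asboolP[N yN]; apply/asboolP.
exists (`|a| * M + N) => n; rewrite (le_trans (ler_normD _ _))// lerD//.
by rewrite [leLHS]normrZ; exact: (ler_wpM2l (normr_ge0 a) (xM n)).
Qed.

HB.instance Definition _ :=
  GRing.isSubmodClosed.Build R seq_product bounded_seq bounded_seq_submod_closed.

Definition linf : Type := {x : seq_product | x \in bounded_seq}.

HB.instance Definition _ := SubType.on linf.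
HB.instance Definition _ := [Choice of linf by <:].
HB.instance Definition _ := [SubChoice_isSubLmodule of linf by <:].

End seq_product.

Section ultraproduct.
Context (R : realType) (X : nat -> completeNormedModType R).
Context (U : set_system nat) (FU : UltraFilter U).
Implicit Types x y : linf X.

Definition normseq x : nat -> R := fun n => `|val x n|.

(* [lim] is total; this makes [lim (u @ U)] the genuine limit of u along U
   for every bounded u. *)
Lemma ultra_cvg (u : nat -> R) (M : R) :
  (forall n, `|u n| <= M) -> cvg (u @ U).
Proof.
move=> uM.
have FuU : ProperFilter (u @ U) by apply: fmap_proper_filter.
have : (u @ U) [set` `[- M, M]].
  by apply: (@filterE _ U) => n; rewrite /= in_itv/= -ler_norml; exact: uM.
move=> /(segment_compact FuU)[l [_ ul]].
apply/cvg_ex; exists l => V lV.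
have [//|UV] := in_ultra_setVsetC (u @^-1` V) FU.
by have [t [nVt Vt]] := ul (~` V) V UV lV.
Qed.

Lemma normseq_cvg x : cvg (normseq x @ U).
Proof.
have /asboolP[M xM] := valP x.
by apply: (@ultra_cvg _ M) => n; rewrite normr_id.
Qed.

Definition ultranorm x : R := lim (normseq x @ U).

Lemma ultranormP x : normseq x @ U --> ultranorm x.
Proof. exact: normseq_cvg. Qed.
Arguments ultranormP : clear implicits.

Definition null_seq : {pred linf X} := [pred x | ultranorm x == 0].

Lemma ultranorm_le x (M : R) : U [set n | `|val x n| <= M] -> ultranorm x <= M.
Proof. by move=> xM; apply: limr_le; first exact: normseq_cvg. Qed.

Lemma ultranorm_lt x (M : R) : ultranorm x < M -> U [set n | `|val x n| < M].
Proof. by move=> xM; exact: (cvgr_lt _ (ultranormP x) _ xM). Qed.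

Lemma ultranorm_ge0 x : 0 <= ultranorm x.
Proof.
by apply: limr_ge; [exact: normseq_cvg | apply: nearW => n; exact: normr_ge0].
Qed.

Lemma ultranormD x y : ultranorm (x + y) <= ultranorm x + ultranorm y.
Proof.
apply: (ler_cvg_to (ultranormP (x + y)) (cvgD (ultranormP x) (ultranormP y))).
by apply: nearW => n; rewrite /normseq raddfD; exact: ler_normD.
Qed.

Lemma ultranormZ (a : R) x : ultranorm (a *: x) = `|a| * ultranorm x.
Proof.
apply/cvg_lim => //; rewrite [normseq _](_ : _ = fun n => `|a| * normseq x n).
  exact: cvgMr (ultranormP x).
by apply/funext => n; rewrite /normseq linearZ; exact: normrZ.
Qed.

Lemma ultranorm0 : ultranorm 0 = 0.
Proof. by rewrite -(scale0r (0 : linf X)) ultranormZ normr0 mul0r. Qed.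

Lemma ultranormN x : ultranorm (- x) = ultranorm x.
Proof. by rewrite -scaleN1r ultranormZ normrN1 mul1r. Qed.

Lemma null_seq_submod_closed : submod_closed null_seq.
Proof.
split; first by apply/eqP; exact: ultranorm0.
move=> a x y /eqP x0 /eqP y0; apply/eqP/le_anti; rewrite ultranorm_ge0 andbT.
by rewrite (le_trans (ultranormD _ _))// ultranormZ x0 y0 mulr0 addr0.
Qed.

HB.instance Definition _ :=
  GRing.isSubmodClosed.Build R (linf X) null_seq null_seq_submod_closed.

Definition ultraproduct : Type := Quotient.quot null_seq.

HB.instance Definition _ := GRing.Zmodule.on ultraproduct.

Local Open Scope quotient_scope.

Definition ultraclass x : ultraproduct := \pi_(Quotient.quot null_seq) x.

Implicit Types z w : ultraproduct.

Lemma ultraclassK z : ultraclass (repr (z : Quotient.quot null_seq)) = z.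
Proof. exact: reprK. Qed.

Lemma ultraclass_eq x y : ultraclass x = ultraclass y <-> ultranorm (x - y) = 0.
Proof.
have := Quotient.idealrBE null_seq x y; rewrite inE => e.
by split=> [/eqP|/eqP]; [rewrite -e => /eqP | rewrite e => /eqP].
Qed.

Lemma ultraclassD x y : ultraclass (x + y) = ultraclass x + ultraclass y.
Proof. exact: (raddfD \pi_(Quotient.quot null_seq)). Qed.

Lemma ultraclassB x y : ultraclass (x - y) = ultraclass x - ultraclass y.
Proof. exact: (raddfB \pi_(Quotient.quot null_seq)). Qed.

Let urepr z : linf X := repr (z : Quotient.quot null_seq).

Definition ultrascale (a : R) z : ultraproduct := ultraclass (a *: urepr z).

Lemma ultraclassZ a x : ultraclass (a *: x) = ultrascale a (ultraclass x).
Proof.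
apply/ultraclass_eq; rewrite -scalerBr ultranormZ.
by rewrite (ultraclass_eq _ _).1 ?mulr0// ultraclassK.
Qed.

Let scaleA a b z : ultrascale a (ultrascale b z) = ultrascale (a * b) z.
Proof. by rewrite -[z]ultraclassK -!ultraclassZ scalerA. Qed.
Let scale1 : left_id 1 ultrascale.
Proof. by move=> z; rewrite -[z]ultraclassK -ultraclassZ scale1r. Qed.
Let scaleDr : right_distributive ultrascale +%R.
Proof.
move=> a z w; rewrite -[z]ultraclassK -[w]ultraclassK -ultraclassD.
by rewrite -!ultraclassZ scalerDr ultraclassD.
Qed.
Let scaleDl z : {morph ultrascale^~ z : a b / a + b}.
Proof.
by move=> a b /=; rewrite -[z]ultraclassK -!ultraclassZ scalerDl ultraclassD.
Qed.

HB.instance Definition _ :=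
  GRing.Zmodule_isLmodule.Build R ultraproduct scaleA scale1 scaleDr scaleDl.

Definition ultraproduct_norm z : R := ultranorm (urepr z).

Let unorm_class x : ultraproduct_norm (ultraclass x) = ultranorm x.
Proof.
have e : ultranorm (urepr (ultraclass x) - x) = 0.
  by apply/ultraclass_eq; rewrite ultraclassK.
apply/le_anti/andP; split.
  by rewrite -[leLHS](congr1 ultranorm (subrK x _))
    (le_trans (ultranormD _ _))// e add0r.
rewrite -[leLHS](congr1 ultranorm (subrK (urepr (ultraclass x)) _)).
by rewrite (le_trans (ultranormD _ _))// -opprB ultranormN e add0r.
Qed.

Let unormD z w :
  ultraproduct_norm (z + w) <= ultraproduct_norm z + ultraproduct_norm w.
Proof.
rewrite -[z]ultraclassK -[w]ultraclassK -ultraclassD !unorm_class.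
exact: ultranormD.
Qed.

Let unormZ (a : R) z :
  ultraproduct_norm (a *: z) = `|a| * ultraproduct_norm z.
Proof.
by rewrite -[z]ultraclassK -[_ *: _]ultraclassZ !unorm_class ultranormZ.
Qed.

Let unorm_eq0 z : ultraproduct_norm z = 0 -> z = 0.
Proof.
rewrite -[z]ultraclassK unorm_class => z0.
by rewrite -[RHS](subrr (ultraclass 0)) -ultraclassB;
  apply/ultraclass_eq; rewrite !subr0.
Qed.

HB.instance Definition _ :=
  Lmodule_isNormed.Build R ultraproduct unormD unormZ unorm_eq0.

Lemma norm_ultraclass x : `|ultraclass x| = lim ((fun n => `|val x n|) @ U).
Proof. exact: unorm_class. Qed.

Lemma ultraclass_lift z (c : R) : `|z| < c ->
  exists2 x, ultraclass x = z & forall n, `|val x n| <= c.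
Proof.
rewrite -[z]ultraclassK norm_ultraclass; set x := repr _ => xc.
have c0 : 0 <= c by exact: le_trans (ultranorm_ge0 x) (ltW xc).
pose v : seq_product X := fun n => if `|val x n| <= c then val x n else 0.
have vc n : `|v n| <= c by rewrite /v; case: ifPn => // _; rewrite normr0.
have vb : v \in @bounded_seq R X by apply/asboolP; exists c.
exists (exist _ v vb) => //.
apply/ultraclass_eq/le_anti; rewrite ultranorm_ge0 andbT.
apply: ultranorm_le; apply: filterS (ultranorm_lt xc) => n xn.
change (`|v n - val x n| <= 0).
by rewrite /v (ltW xn) subrr normr0.
Qed.

Lemma ultraproduct_complete (F : set_system ultraproduct) :
  ProperFilter F -> cauchy F -> cvg F.
Proof.
move=> FF /cauchyP Fc.
pose h k : R := 2^-1 ^+ k.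
have h0 k : 0 < h k by rewrite exprn_gt0.
have hS k : h k = 2 * h k.+1 by rewrite /h exprS mulrA divff ?mul1r.
have [z Fz] : exists z : nat -> ultraproduct, forall k, F (ball (z k) (h k)).
  have /choice[z Fz] k : exists z, F (ball z (h k)) by exact: Fc.
  by exists z.
have zS k : `|z k.+1 - z k| < 2 * h k.
  have [t [tk tk1]] := filter_ex (filterI (Fz k) (Fz k.+1)).
  move: tk tk1; rewrite -!ball_normE/= => tk tk1.
  rewrite -(subrKA t) (le_lt_trans (ler_normD _ _))// (distrC t).
  by rewrite (lt_le_trans (ltrD tk1 tk))// mulrDl mul1r lerD2r [leRHS]hS
    mulrDl mul1r lerDl ltW.
have [e eS eh] : exists2 e : nat -> linf X,
    (forall k, ultraclass (e k) = z k.+1 - z k) &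
    (forall k n, `|val (e k) n| <= 2 * h k).
  have /choice[e eP] : forall k, exists x, ultraclass x = z k.+1 - z k /\
      forall n, `|val x n| <= 2 * h k.
    by move=> k; have [x] := ultraclass_lift (zS k); exists x.
  by exists e => k; case: (eP k).
pose y := fix y m := if m is k.+1 then y k + e k else urepr (z 0%N).
have yz m : ultraclass (y m) = z m.
  elim: m => [|m IH]; first exact: ultraclassK.
  by rewrite ultraclassD IH eS addrC subrK.
have ydist m p n : `|val (y (p + m)%N) n - val (y m) n| <= 4 * h m - 4 * h (p + m)%N.
  elim: p => [|p IH]; first by rewrite !subrr normr0.
  have -> : val (y (p.+1 + m)%N) n - val (y m) n =
      (val (y (p + m)%N) n - val (y m) n) + val (e (p + m)%N) n.
    change (val (y (p + m)%N) n + val (e (p + m)%N) n - val (y m) n =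
      (val (y (p + m)%N) n - val (y m) n) + val (e (p + m)%N) n).
    by rewrite addrAC.
  rewrite (le_trans (ler_normD _ _))// (le_trans (lerD IH (eh _ _)))//.
  rewrite -addrA lerD2l addSn; move: (hS (p + m)%N); lra.

have h_lim eps : 0 < eps -> exists m, 5 * h m < eps.
  move=> eps0; have : geometric 5 (2^-1 : R) @ \oo --> 0.
    by apply: cvg_geometric; rewrite ger0_norm// invf_lt1// ltr1n.
  move=> /cvgrPdist_lt/(_ _ eps0)[m _ /(_ m (leqnn m))].
  by rewrite /= sub0r normrN gtr0_norm ?mulr_gt0//; exists m.
have ycvg n : cvg ((fun m => val (y m) n) @ \oo).
  apply/cauchy_cvgP/cauchyP => eps eps0.
  have [m hm] := h_lim _ eps0; exists (val (y m) n).
  exists m => // p /= mp; rewrite -ball_normE/= distrC -(subnK mp).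
  rewrite (le_lt_trans (ydist _ _ _))//.
  by move: (h0 m) (h0 (p - m + m)%N) hm; lra.
pose s : seq_product X := fun n => lim ((fun m => val (y m) n) @ \oo).
have sy m n : `|s n - val (y m) n| <= 4 * h m.
  have sc : (fun p => `|val (y p) n - val (y m) n|) @ \oo -->
      `|s n - val (y m) n|.
    by apply: cvg_norm; apply: cvgB; [exact: ycvg | exact: cvg_cst].
  apply: (cvgr_to_le sc); exists m => // p /= mp; rewrite -{1}(subnK mp).
  by rewrite (le_trans (ydist _ _ _))// gerBl mulr_ge0 ?ltW.
have sb : s \in @bounded_seq R X.
  have /asboolP[M yM] := valP (y 0%N).
  apply/asboolP; exists (4 * h 0%N + M) => n.
  by rewrite -(subrK (val (y 0%N) n) (s n)) (le_trans (ler_normD _ _))// lerD.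
pose S : ultraproduct := ultraclass (exist _ s sb).
have Sz m : `|S - z m| <= 4 * h m.
  rewrite -yz -ultraclassB norm_ultraclass; apply: ultranorm_le.
  by apply: filterE => n; exact: sy.
apply/cvg_ex; exists S; apply/cvgrPdist_lt => eps eps0.
have [m hm] := h_lim _ eps0.
apply: filterS (Fz m) => t; rewrite -ball_normE/= => zt.
rewrite -(subrKA (z m)) (le_lt_trans (ler_normD _ _))//.
by rewrite (le_lt_trans (lerD (Sz m) (ltW zt)))//; move: hm; lra.
Qed.

HB.instance Definition _ :=
  Uniform_isComplete.Build ultraproduct ultraproduct_complete.

End ultraproduct.

Arguments ultraproduct {R} X {U} FU.
Arguments ultraclass {R X U} FU x.

(* Main.v *)
Require Import Defs.
From HB Require Import structures.
From mathcomp Require Import all_boot all_order all_algebra.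
From mathcomp Require Import lra.
From mathcomp Require Import all_classical all_reals all_analysis.

(** An ultraproduct turns approximate statements that hold uniformly in its
    factors into exact ones.

    Let [z] be a unit vector of the ultraproduct and write it as the class of
    a sequence [x] with [`|x n| = 1] for [U]-many [n] ([unit_sphere_lift]). For
    these [n] the GL condition at [x n] with error [1 / n.+1] provides a
    norm-one functional [f n] that is nearly 1 at [x n]. The limit of
    [f n (v n)] along [U] defines a contractive linear functional [F] on the
    ultraproduct ([ultra_functional]). The ultrafilter being free, the errors
    tend to 0 along it ([free_ultra_cvg_infty]), so [F z = 1].

    Given another unit vector [y], the class of [v], the GL condition also
    gives points [a n] and [b n] of the two opposite slices of [f n] with
    [`|v n - a n| + `|v n - b n| < 2 + 1 / n.+1] ([GL_slice_points]). Their
    classes [z1], [z2] lie in the unit ball and satisfy [F z1 >= 1],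
    [- F z2 >= 1] and [`|y - z1| + `|y - z2| <= 2]. As [F] is contractive,
    [2 <= F (z1 - z2) <= `|z1 - z2|], and the triangle inequality forces
    equality everywhere ([ultraproduct_norming]).

    The GL property of the ultraproduct follows, because [z1] and [z2] lie in
    the opposite slices of [F] of every width ([edist_inf_slices]). *)

Set Implicit Arguments.
Unset Strict Implicit.
Unset Printing Implicit Defensive.

Import Order.TTheory GRing.Theory Num.Theory.
Import numFieldNormedType.Exports.

Local Open Scope classical_set_scope.
Local Open Scope ring_scope.

(** * Distances to sets *)

Section distances.
Context (R : realType) (X : normedModType R).
Implicit Types (A B : set X) (x y a b : X) (r c : R).

Lemma edist_inf_lt A y r :
  (edist_inf A y < r%:E)%E -> exists2 a, A a & `|y - a| < r.
Proof.
move=> /ereal_inf_lt[_ [a Aa <-]] /edist_lt_ball; rewrite -ball_normE/= => ya.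
by exists a.
Qed.

Lemma edist_inf_le A y a : A a -> (edist_inf A y <= `|y - a|%:E)%E.
Proof.
move=> Aa; apply/lee_addgt0Pr => e e0.
have ea : (edist (y, a) <= `|y - a|%:E + e%:E)%E.
  rewrite -EFinD; apply: edist_fin; first by rewrite ltr_wpDl.
  by rewrite -ball_normE/= ltrDl.
by apply: le_trans ea; apply: ereal_inf_lbound; exists a.
Qed.

(** An infimum is only approached, so the slack [c - (p + q)] between the sum
    of the two distances and [c] is shared equally between the two points. *)
Lemma edist_infD_lt A B y c :
  (edist_inf A y + edist_inf B y < c%:E)%E ->
  exists a b, [/\ A a, B b & `|y - a| + `|y - b| < c].
Proof.
have := edist_inf_ge0 A y; have := edist_inf_ge0 B y.
move EA : (edist_inf A y) => p; move EB : (edist_inf B y) => q.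
case: p EA => [p| |] EA //; case: q EB => [q| |] EB // _ _.
rewrite -EFinD lte_fin => pqc.
have d0 : 0 < (c - (p + q)) / 2 by rewrite divr_gt0// subr_gt0.
have [|a Aa ya] := @edist_inf_lt A y (p + (c - (p + q)) / 2).
  by rewrite EA lte_fin ltrDl.
have [|b Bb yb] := @edist_inf_lt B y (q + (c - (p + q)) / 2).
  by rewrite EB lte_fin ltrDl.
by exists a, b; split=> //; lra.
Qed.

End distances.

(** * Norm-one functionals and their slices *)

Section dual_sphere.
Context (R : realType) (X : completeNormedModType R).
Implicit Types (f : {linear X -> R^o}) (x y a b : X).

(** Continuity serves to bound the set whose supremum is [dual_norm f]: only
    then is the supremum an upper bound. *)
Lemma dual_sphere_le f x : dual_sphere f -> `|f x| <= `|x|.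
Proof.
move=> [fc f1]; have [->|x0] := eqVneq x 0; first by rewrite linear0 !normr0.
have nx0 : 0 < `|x| by rewrite normr_gt0.
have ub : has_ubound [set `|f y| | y in @unit_ball R X].
  have [M M0 fM] := pinfty_ex_gt0 ((linear_boundedP _).1
    (continuous_linear_bounded _ (fc 0))).
  exists M => _ [y y1 <-]; rewrite (le_trans (fM y))// -[leRHS]mulr1.
  by rewrite ler_wpM2l// ltW.
have /(ub_le_sup ub) : [set `|f y| | y in @unit_ball R X] `|f (`|x|^-1 *: x)|.
  exists (`|x|^-1 *: x) => //.
  by rewrite /unit_ball/= normrZ normfV normr_id mulVf// gt_eqF.
rewrite -[sup _]/(dual_norm f) f1 linearZ normrZ normfV normr_id.
by rewrite ler_pdivrMl// mulr1.
Qed.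

(** A functional dominated by the norm has norm at most 1, and the value 1 at
    a single unit vector makes it exactly 1. *)
Lemma dual_sphere_attained f x :
  (forall y, `|f y| <= `|y|) -> unit_sphere x -> f x = 1 -> dual_sphere f.
Proof.
move=> fle x1 fx; split.
  move=> y; apply: bounded_linear_continuous; apply/linear_boundedP.
  exists 1; split; first exact: real1.
  by move=> r r1 v; rewrite (le_trans (fle v))// ler_peMl// ltW.
have fub : ubound [set `|f y| | y in @unit_ball R X] 1.
  by move=> _ [y y1 <-]; exact: le_trans (fle y) y1.
have f1 : [set `|f y| | y in @unit_ball R X] 1.
  by exists x; rewrite ?fx ?normr1// /unit_ball/= x1.
apply/le_anti/andP; split; first by apply: ge_sup => //; exists 1.
by apply: ub_le_sup => //; exists 1.
Qed.

(** The GL condition with its two infimal distances replaced by actual points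
    of the slices. In this form it consists of finitely many inequalities
    between reals for each [y], which is what passes to a limit along an
    ultrafilter. *)
Lemma GL_slice_points (x : X) (e : R) : GL_space X -> unit_sphere x -> 0 < e ->
  exists f, [/\ forall v, `|f v| <= `|v|, 1 - e < f x &
    forall y, unit_sphere y -> exists a b, [/\ `|a| <= 1, `|b| <= 1,
      1 - e < f a, 1 - e < - f b & `|y - a| + `|y - b| < 2 + e]].
Proof.
move=> GLX x1 e0; have [f [fS [_ fx] fy]] := GLX x x1 e e0.
exists f; split=> // [v|y /fy]; first exact: dual_sphere_le.
move=> /edist_infD_lt[a [_ [[a1 fa] [b [b1 fb] <-] yab]]].
by exists a, (- b); split=> //; rewrite ?normrN// linearN opprK.
Qed.

(** This is how the exact conclusion for the ultraproduct yields the GL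
    inequality: a point at which [f] is 1 and one at which [- f] is 1 lie in
    the two opposite slices for every width [e] at once. *)
Lemma edist_inf_slices f (e : R) y a b :
  0 < e -> unit_sphere a -> unit_sphere b -> f a = 1 -> - f b = 1 ->
  (edist_inf (slice f e) y + edist_inf (opp_slice f e) y
     <= (`|y - a| + `|y - b|)%:E)%E.
Proof.
move=> e0 a1 b1 fa fb; rewrite EFinD.
apply: leeD; apply: edist_inf_le.
  by split; rewrite /unit_ball/= ?a1// fa ltrBlDr ltrDl.
exists (- b); rewrite ?opprK//.
by split; rewrite /unit_ball/= ?normrN ?b1// linearN fb ltrBlDr ltrDl.
Qed.

End dual_sphere.

(** * Limits along the ultrafilter *)

(** Since [U] is an ultrafilter and the intersection of its members is empty,
    it contains the complement of every singleton, hence every tail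
    [N, N + 1, ...]. *)
Lemma free_ultra_cvg_infty (U : set_system nat) :
  UltraFilter U -> free_filter U -> U --> \oo.
Proof.
move=> FU freeU A [N _ NA]; apply: filterS NA _.
elim: N => [|N IH]; first exact: filterE.
have UN : U (~` [set N]).
  have [UN|//] := in_ultra_setVsetC [set N] FU.
  suff : (\bigcap_(B in U) B) N by rewrite freeU.
  by move=> B /(filterI UN)/filter_ex[_ [-> ]].
apply: filterS (filterI IH UN) => k /= [Nk kN].
by rewrite ltn_neqAle Nk andbT eq_sym; apply/eqP.
Qed.

Section ultraproduct_theory.
Context (R : realType) (U : set_system nat) (FU : UltraFilter U).
Context (X : nat -> completeNormedModType R).
Implicit Types (z : ultraproduct X FU) (x v : linf X).

Lemma linf_seq (x : forall n, X n) (M : R) : (forall n, `|x n| <= M) ->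
  exists v : linf X, forall n, val v n = x n.
Proof.
move=> xM; have xb : (x : seq_product X) \in @bounded_seq R X.
  by apply/asboolP; exists M.
by exists (exist _ (x : seq_product X) xb).
Qed.

Lemma norm_ultraclass_cvg x :
  (fun n => `|val x n|) @ U --> `|ultraclass FU x|.
Proof. by rewrite norm_ultraclass; exact: (@ultranormP R X U FU x). Qed.

Lemma norm_ultraclass_le x (M : R) :
  (forall n, `|val x n| <= M) -> `|ultraclass FU x| <= M.
Proof.
by move=> xM; rewrite norm_ultraclass; apply: ultranorm_le; exact: filterE.
Qed.

Lemma norm_ultraclassB_cvg x v :
  (fun n => `|val x n - val v n|) @ U --> `|ultraclass FU x - ultraclass FU v|.
Proof. by rewrite -ultraclassB; exact: (@norm_ultraclass_cvg (x - v)). Qed.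

(** A representative of a unit vector has norms tending to 1, so it can be
    normalised coordinatewise without leaving its class. The coordinates that
    vanish cannot be normalised (some [X n] may even be trivial), which is why
    norm one holds only for [U]-many indices: the others keep the value 0,
    through [0^-1 = 0]. *)
Lemma unit_sphere_lift z : unit_sphere z ->
  exists x, [/\ ultraclass FU x = z, forall n, `|val x n| <= 1 &
    U [set n | `|val x n| = 1]].
Proof.
move=> z1; have [|x xz _] := @ultraclass_lift R X U FU z 2.
  by rewrite z1 ltr1n.
have xcvg : (fun n => `|val x n|) @ U --> (1 : R).
  by rewrite -z1 -xz; exact: norm_ultraclass_cvg.
have nv n : `| `|val x n|^-1 *: val x n | = (val x n != 0)%:R.
  rewrite normrZ normfV normr_id; have [->|x0] := eqVneq (val x n) 0.
    by rewrite normr0 mulr0.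
  by rewrite mulVf// normr_eq0.
have [|v vE] := @linf_seq (fun n => `|val x n|^-1 *: val x n) 1.
  by move=> n; rewrite nv; case: eqP.
have vx n : `|val v n - val x n| <= `|1 - `|val x n| |.
  rewrite vE; have [->|x0] := eqVneq (val x n) 0.
    by rewrite scaler0 subrr normr0.
  rewrite -[X in _ - X]scale1r -scalerBl normrZ -[X in _ * X]normr_id -normrM.
  by rewrite mulrBl mul1r mulVf ?normr_eq0.
exists v; split=> [|n|]; last 1 first.
- apply: filterS (cvgr_gt _ xcvg 0 ltr01) => n /=.
  by rewrite vE nv normr_gt0 => ->.
- rewrite -xz; apply/eqP; rewrite -subr_eq0 -normr_le0.
  have c0 : (fun n => `|1 - `|val x n| |) @ U --> (0 : R).
    have := cvg_norm (cvgB (cvg_cst (1 : R)) xcvg).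
    by rewrite subrr normr0; exact.
  by apply: (ler_cvg_to (@norm_ultraclassB_cvg v x) c0); exact: nearW.
- by rewrite vE nv; case: eqP.
Qed.

(** The limit along [U] of contractive functionals on the factors. The bound
    by the norm does two things: the values stay bounded, so the limit exists,
    and two representatives of a class have values whose difference tends
    to 0, so the limit depends on the class only. *)
Lemma ultra_functional (f : forall n, {linear X n -> R^o}) :
  (forall n (u : X n), `|f n u| <= `|u|) ->
  exists F : {linear ultraproduct X FU -> R^o},
    forall x, (fun n => f n (val x n)) @ U --> F (ultraclass FU x).
Proof.
move=> f1.
have fcvg x : cvg ((fun n => f n (val x n) : R) @ U).
  have /asboolP[M xM] := valP x; apply: (@ultra_cvg R U FU _ M) => n.
  exact: le_trans (f1 _ _) (xM n).
have /choice[F FP] z : exists l : R^o, forall x, ultraclass FU x = z ->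
    (fun n => f n (val x n) : R) @ U --> (l : R).
  have [|x0 x0z _] := @ultraclass_lift R X U FU z (`|z| + 1).
    by rewrite ltrDl.
  exists (lim ((fun n => f n (val x0 n) : R) @ U)) => x xz.
  have d0 : (fun n => f n (val x n) - f n (val x0 n) : R) @ U --> (0 : R).
    apply/norm_cvg0P; have c := @norm_ultraclassB_cvg x x0.
    rewrite xz x0z subrr normr0 in c.
    apply: (squeeze_cvgr _ (cvg_cst (0 : R)) c).
    by apply: nearW => n /=; rewrite normr_ge0 -linearB; exact: f1.
  have c := cvgD d0 (fcvg x0); rewrite add0r in c.
  have -> : (fun n => f n (val x n) : R) =
      (fun n => f n (val x n) - f n (val x0 n) : R) +
      (fun n => f n (val x0 n) : R).
    by apply/funext => n; rewrite [RHS]subrK.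
  exact: c.
have Flin : linear F.
  move=> a z w.
  have [|x xz _] := @ultraclass_lift R X U FU z (`|z| + 1); first by rewrite ltrDl.
  have [|y yw _] := @ultraclass_lift R X U FU w (`|w| + 1); first by rewrite ltrDl.
  have e : ultraclass FU (a *: x + y) = a *: z + w.
    by rewrite ultraclassD ultraclassZ xz yw.
  have c := cvgD (cvgM (cvg_cst (a : R)) (FP z x xz)) (FP w y yw).
  apply: (cvg_unique _ (FP _ _ e)) => //.
  have -> : (fun n => f n (val (a *: x + y) n) : R) =
      (fun n => a * (f n (val x n) : R)) + (fun n => f n (val y n) : R).
    by apply/funext => n; exact: linearP.
  exact: c.
pose FL := GRing.isLinear.Build R (ultraproduct X FU) R^o *:%R F Flin.
pose G : {linear ultraproduct X FU -> R^o} := HB.pack F FL.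
by exists G => x; exact: FP.
Qed.

(** In the [n]-th factor the GL condition holds up to [1 / n.+1], and this
    error disappears in the limit, leaving non-strict inequalities. They are
    squeezed into equalities: [1 <= F z1 <= `|z1| <= 1], likewise for [- z2], and
    [2 <= F (z1 - z2) <= `|z1 - z2| <= `|y - z1| + `|y - z2| <= 2]. *)
Lemma ultraproduct_norming (freeU : free_filter U)
    (GLX : forall n, GL_space (X n)) z :
  unit_sphere z ->
  exists f : {linear ultraproduct X FU -> R^o},
      [/\ dual_sphere f, f z = 1 &
        forall y : ultraproduct X FU, unit_sphere y ->
        exists z1 z2 : ultraproduct X FU,
          [/\ unit_sphere z1, unit_sphere z2, f z1 = 1, - f z2 = 1 &
            `|y - z1| + `|y - z2| = 2]].
Proof.
move=> z1; have [x [xz x1 Ux]] := unit_sphere_lift z1.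
pose e n : R := harmonic n.
have ecvg : e @ U --> (0 : R).
  exact: cvg_comp (free_ultra_cvg_infty FU freeU) (@cvg_harmonic R).
have fex n : exists f : {linear X n -> R^o},
    (forall u, `|f u| <= `|u|) /\ (`|val x n| = 1 -> 1 - e n < f (val x n) /\
    forall y, unit_sphere y -> exists a b, [/\ `|a| <= 1, `|b| <= 1,
      1 - e n < f a, 1 - e n < - f b & `|y - a| + `|y - b| < 2 + e n]).
  have [xn|xn] := pselect (`|val x n| = 1).
    have [f [? ? ?]] := GL_slice_points (GLX n) xn (harmonic_gt0 n : 0 < e n).
    by exists f.
  (* These indices form a set outside U, so any contraction will do. *)
  by exists \0; split=> // u; rewrite normr0.
pose f n : {linear X n -> R^o} := sval (cid (fex n)).
have fP n := svalP (cid (fex n)).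
have fle n (u : X n) : `|f n u| <= `|u| by case: (fP n).
have [F Fcvg] := @ultra_functional f fle.
have Fle w : `|F w| <= `|w|.
  have [|v <- _] := @ultraclass_lift R X U FU w (`|w| + 1); first by rewrite ltrDl.
  apply: (ler_cvg_to (cvg_norm (Fcvg v)) (@norm_ultraclass_cvg v)).
  exact: nearW.
have one_sub_cvg : (fun n => 1 - e n) @ U --> (1 : R).
  by have := cvgB (cvg_cst (1 : R)) ecvg; rewrite subr0; exact.
have Fz : F z = 1.
  apply/le_anti/andP; split.
    by rewrite (le_trans (ler_norm _))// (le_trans (Fle z))// z1.
  rewrite -xz; apply: (ler_cvg_to one_sub_cvg (Fcvg x)).
  by apply: filterS Ux => n xn; have [_ /(_ xn)[/ltW]] := fP n.
exists F; split=> // [|y y1]; first exact: (dual_sphere_attained Fle z1).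
have [v [vy v1 Uv]] := unit_sphere_lift y1.
(* The norm bounds are required for every index, so that the chosen points
   form bounded sequences; the slice conditions only where they make sense. *)
pose good n (ab : X n * X n) := [/\ `|ab.1| <= 1, `|ab.2| <= 1 &
  `|val x n| = 1 -> `|val v n| = 1 -> [/\ 1 - e n < f n ab.1,
    1 - e n < - f n ab.2 &
    `|val v n - ab.1| + `|val v n - ab.2| < 2 + e n]].
have abP n : {ab | good n ab}.
  apply: cid; have [[xn vn]|xvn] := pselect (`|val x n| = 1 /\ `|val v n| = 1).
    have [_ /(_ xn)[_ /(_ _ vn)[a [b [? ? ? ? ?]]]]] := fP n.
    by exists (a, b).
  by exists (0, 0); split; rewrite ?normr0//= => xn vn; case: xvn.
have [a aE] := @linf_seq (fun n => (sval (abP n)).1) 1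
  (fun n => let: And3 h _ _ := svalP (abP n) in h).
have [b bE] := @linf_seq (fun n => (sval (abP n)).2) 1
  (fun n => let: And3 _ h _ := svalP (abP n) in h).
have a1 : `|ultraclass FU a| <= 1.
  by apply: norm_ultraclass_le => n; rewrite aE; have [] := svalP (abP n).
have b1 : `|ultraclass FU b| <= 1.
  by apply: norm_ultraclass_le => n; rewrite bE; have [] := svalP (abP n).
have Uab : U [set n | [/\ 1 - e n < f n (val a n), 1 - e n < - f n (val b n) &
    `|val v n - val a n| + `|val v n - val b n| < 2 + e n]].
  apply: filterS (filterI Ux Uv) => n [xn vn].
  by rewrite /= aE bE; have [_ _] := svalP (abP n); exact.
have Fa : 1 <= F (ultraclass FU a).
  apply: (ler_cvg_to one_sub_cvg (Fcvg a)).
  by apply: filterS Uab => n [/ltW].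
have Fb : 1 <= - F (ultraclass FU b).
  apply: (ler_cvg_to one_sub_cvg (cvgN (Fcvg b))).
  by apply: filterS Uab => n [_ /ltW].
have yab : `|y - ultraclass FU a| + `|y - ultraclass FU b| <= 2.
  have lhs := cvgD (@norm_ultraclassB_cvg v a) (@norm_ultraclassB_cvg v b).
  have rhs := cvgD (cvg_cst (2 : R)) ecvg.
  rewrite addr0 in rhs; rewrite -vy; apply: (ler_cvg_to (lhs _) (rhs _ _)).
  by apply: filterS Uab => n [_ _ /ltW].
have Fla := le_trans (ler_norm _) (Fle (ultraclass FU a)).
have Flb := le_trans (ler_norm _) (Fle (- ultraclass FU b)).
rewrite linearN normrN in Flb.
have Fab := le_trans (ler_norm _) (Fle (ultraclass FU a - ultraclass FU b)).
rewrite linearB in Fab.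
have := ler_distD y (ultraclass FU a) (ultraclass FU b).
rewrite (distrC _ y) => tri.
exists (ultraclass FU a), (ultraclass FU b).
by split; rewrite ?/unit_sphere /=; lra.
Qed.

End ultraproduct_theory.

Theorem proposition2p2 (R : realType) (U : set_system nat)
    (FU : UltraFilter U) (freeU : free_filter U)
    (X : nat -> completeNormedModType R) (GLX : forall n, GL_space (X n)) :
  (forall z : ultraproduct X FU, unit_sphere z ->
    exists f : {linear ultraproduct X FU -> R^o},
      [/\ dual_sphere f, f z = 1 &
        forall y : ultraproduct X FU, unit_sphere y ->
        exists z1 z2 : ultraproduct X FU,
          [/\ unit_sphere z1, unit_sphere z2, f z1 = 1, - f z2 = 1 &
            `|y - z1| + `|y - z2| = 2]])
  /\ GL_space (ultraproduct X FU).
Proof.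
split=> [z z1|z z1 e e0]; first exact: ultraproduct_norming.
have [f [fS fz fy]] := ultraproduct_norming freeU GLX z1.
exists f; split=> // [|y /fy[a [b [a1 b1 fa fb yab]]]].
  by split; rewrite /unit_ball/= ?z1// fz ltrBlDr ltrDl.
apply: le_lt_trans (edist_inf_slices _ e0 a1 b1 fa fb) _.
by rewrite yab lte_fin ltrDl.
Qed.
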